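(* Let $p$ be a prime number, $d$ a positive integer, and $f(t_1,\dots,t_d)\in\mathbb{Z}[t_1,\dots,t_d]$. Then the $d$-tuple multiple sequence of integers $(r_{n_1,\dots,n_d}(f))_{(n_1,\dots,n_d)\in\mathbb{Z}_{>0}^d}$ and the multiple sequence of its non-$p$-parts $(r_{n_1,\dots,n_d}(f)_{\text{non-}p})$ both converge in $\mathbb{Z}_p$. Moreover, the limit value $\lim_{n_1,\dots,n_d\to\infty} r_{n_1,\dots,n_d}(f)$ is $0$ if and only if $f(1,\dots,1)\equiv 0 \bmod p$.
   Context: For an integral domain $R$ and polynomials $f=a_mt^m+\cdots+a_0$, $g=b_nt^n+\cdots+b_0$ in $R[t]$ with $a_m,b_n\neq0$, the resultant $\mathrm{Res}(f,g)\in R$ is the determinant of the $(m+n)\times(m+n)$ Sylvester matrix of $f$ and $g$ ($n$ shifted rows of coefficients of $f$ followed by $m$ shifted rows of coefficients of $g$); equivalently $\mathrm{Res}(f,g)=a_m^n\prod_i g(\alpha_i)$, where $\alpha_i$ are the roots of $f$ (with multiplicity) in an algebraic closure of $\mathrm{Frac}(R)$; we put $\mathrm{Res}(f,0)=0$ for $f$ of positive degree. For $f\in\mathbb{Z}[t_1,\dots,t_d]$ and positive integers $n_1,\dots,n_d$, $$r_{n_1,\dots,n_d}(f)=\mathrm{Res}(t_1^{p^{n_1}}-1,\,\mathrm{Res}(t_2^{p^{n_2}}-1,\dots,\mathrm{Res}(t_d^{p^{n_d}}-1,f)\cdots))\in\mathbb{Z},$$ where the resultant involving $t_i^{p^{n_i}}-1$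 is taken with respect to the variable $t_i$ (the other variables being in the coefficient ring). $|\cdot|_p$ is the $p$-adic absolute value with $|p|_p=1/p$, and for an integer $m$ its non-$p$-part is $m_{\text{non-}p}:=m|m|_p$ (so $0_{\text{non-}p}=0$). A multiple sequence $(a_{n_1,\dots,n_d})$ converges to $\alpha$, written $\lim_{n_1,\dots,n_d\to\infty}a_{n_1,\dots,n_d}=\alpha$, if for all $\epsilon>0$ there is $N>0$ such that $|a_{n_1,\dots,n_d}-\alpha|_p<\epsilon$ for all $n_1,\dots,n_d>N$. *)

(* Defs.v *)
From HB Require Import structures.
From mathcomp Require Import all_boot all_order all_fingroup all_algebra.
From mathcomp Require Import zify boolp mpoly.

Set Implicit Arguments.
Unset Strict Implicit.
Unset Printing Implicit Defensive.

Import Order.TTheory GRing.Theory Num.Theory.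

Local Open Scope ring_scope.

(* Res(f, g).  [Sylvester_mx] lists coefficients by increasing degree, so       *)
(* [resultant f g] is (-1)^(mn) Res(f, g); hence the swap.  [Res_sylvester]     *)
(* recovers the determinant of the usual (decreasing degree) Sylvester matrix.  *)
Definition Res (R : nzRingType) (f g : {poly R}) : R := resultant g f.

Lemma sylvester_entry (R : nzRingType) (f g : {poly R}) (m n i j : nat) :
    (size f <= m.+1)%N -> (size g <= n.+1)%N -> (i < m + n)%N -> (j < m + n)%N ->
  let i' := (m + n - i.+1)%N in let j' := (m + n - j.+1)%N in
  (if (i < m)%N then g`_(j - i) *+ (i <= j)
   else f`_(j - (i - m)) *+ (i - m <= j)) =
  if (i' < n)%N then if (i' <= j' <= m + i')%N then f`_(m + i' - j') else 0
  else if (i' - n <= j' <= i')%N then g`_(i' - j') else 0.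
Proof.
move=> sf sg Hi Hj i' j'; rewrite /i' /j' {i' j'}.
case: ltnP => im.
  have -> : (m + n - i.+1 < n)%N = false by lia.
  have -> : (m + n - j.+1 <= m + n - i.+1)%N = (i <= j)%N by lia.
  case: (leqP i j) => ij; rewrite ?andbF // andbT.
  have -> : (m + n - i.+1 - (m + n - j.+1) = j - i)%N by lia.
  case: leqP => lt; rewrite mulr1n // nth_default //.
  by apply: leq_trans sg _; lia.
have -> : (m + n - i.+1 < n)%N by lia.
have -> : (m + n - j.+1 <= m + (m + n - i.+1))%N = (i - m <= j)%N by lia.
case: (leqP (i - m) j) => ij; rewrite ?andbF // andbT.
have -> : (m + (m + n - i.+1) - (m + n - j.+1) = j - (i - m))%N by lia.
case: leqP => lt; rewrite mulr1n // nth_default //.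
by apply: leq_trans sf _; lia.
Qed.

Lemma Res_sylvester (R : comNzRingType) (f g : {poly R}) :
  let m := (size f).-1 in let n := (size g).-1 in
  Res f g = \det (\matrix_(i < m + n, j < m + n)
    if (i < n)%N then if (i <= j <= m + i)%N then f`_(m + i - j) else 0
    else if (i - n <= j <= i)%N then g`_(i - j) else 0).
Proof.
move=> m n; rewrite /Res /resultant; set A := \matrix_(_, _) _.
pose s := perm (@rev_ord_inj (m + n)).
have -> : Sylvester_mx g f = row_perm s (col_perm s A).
  apply/matrixP => i j; rewrite Sylvester_mxE [RHS]mxE [RHS]mxE [RHS]mxE !permE.
  rewrite -(@sylvester_entry _ f g m n i j) ?leqSpred ?ltn_ord //.
  by case: splitP => k ik; rewrite -/m in k ik *; rewrite ik // addKn.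
rewrite row_permE col_permE !det_mulmx !det_perm mulrCA.
by rewrite -exprD odd_permV addnn -signr_odd odd_double expr0 mulr1.
Qed.

Lemma Res_f0 (R : comNzRingType) (f : {poly R}) : (1 < size f)%N -> Res f 0 = 0.
Proof.
move=> f1; rewrite Res_sylvester size_poly0 addn0.
have m0 : (0 < (size f).-1)%N by case: (size f) f1 => [|[]].
rewrite (expand_det_row _ (Ordinal m0)) big1 // => j _.
by rewrite mxE coef0 /= if_same mul0r.
Qed.


Lemma modz_modz_dvd (m n d : int) : (d %| n)%Z -> ((m %% n)%Z = m %[mod d])%Z.
Proof.
by move=> /dvdzP[q ->]; rewrite {2}(divz_eq m (q * d)) mulrA modzMDl.
Qed.

Section PadicInt.

Variable p : nat.

(* An element of Z_p = lim Z/p^k, given by its residues in [0, p^k).            *)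
Record padic_int := PadicInt {
  residue :> nat -> int;
  residueP : forall k, residue k = (residue k.+1 %% p%:Z ^+ k)%Z }.

Lemma padic_intP (x y : padic_int) : residue x =1 residue y -> x = y.
Proof.
case: x y => [x Hx] [y Hy] /= /funext eqxy; subst y.
by congr PadicInt; apply: Prop_irrelevance.
Qed.

HB.instance Definition _ := gen_eqMixin padic_int.
HB.instance Definition _ := gen_choiceMixin padic_int.

Lemma residue_mod (x : padic_int) k : (x k %% p%:Z ^+ k)%Z = x k.
Proof. by rewrite [x k]residueP modz_mod. Qed.

Lemma residueS (x : padic_int) k : (x k.+1 = x k %[mod p%:Z ^+ k])%Z.
Proof. by rewrite [x k]residueP modz_mod. Qed.

Lemma padic_of_subproof (u : nat -> int) :
  (forall k, u k.+1 = u k %[mod p%:Z ^+ k])%Z ->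
  forall k, (u k %% p%:Z ^+ k)%Z =
    ((u k.+1 %% p%:Z ^+ k.+1)%Z %% p%:Z ^+ k)%Z.
Proof. by move=> uS k; rewrite modz_modz_dvd ?uS // exprS dvdz_mull. Qed.

Definition padic_of (u : nat -> int)
    (uS : (forall k, u k.+1 = u k %[mod p%:Z ^+ k])%Z) : padic_int :=
  PadicInt (padic_of_subproof uS).

Lemma padic_const_subproof (m : int) k : (m = m %[mod p%:Z ^+ k])%Z.
Proof. by []. Qed.

Lemma padic_add_subproof (x y : padic_int) k :
  (x k.+1 + y k.+1 = x k + y k %[mod p%:Z ^+ k])%Z.
Proof. by rewrite -modzDm !residueS modzDm. Qed.

Lemma padic_opp_subproof (x : padic_int) k :
  (- x k.+1 = - x k %[mod p%:Z ^+ k])%Z.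
Proof. by apply/eqP; rewrite eqz_mod_dvd opprK addrC -eqz_mod_dvd residueS. Qed.

Lemma padic_mul_subproof (x y : padic_int) k :
  (x k.+1 * y k.+1 = x k * y k %[mod p%:Z ^+ k])%Z.
Proof. by rewrite -modzMm !residueS modzMm. Qed.

Definition padic_const (m : int) := padic_of (padic_const_subproof m).
Definition padic_add x y := padic_of (padic_add_subproof x y).
Definition padic_opp x := padic_of (padic_opp_subproof x).
Definition padic_mul x y := padic_of (padic_mul_subproof x y).

Lemma padic_addA : associative padic_add.
Proof. by move=> x y z; apply: padic_intP => k /=; rewrite modzDmr modzDml addrA. Qed.
Lemma padic_addC : commutative padic_add.
Proof. by move=> x y; apply: padic_intP => k /=; rewrite addrC. Qed.
Lemma padic_add0 : left_id (padic_const 0) padic_add.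
Proof. by move=> x; apply: padic_intP => k /=; rewrite mod0z add0r residue_mod. Qed.
Lemma padic_addN : left_inverse (padic_const 0) padic_opp padic_add.
Proof. by move=> x; apply: padic_intP => k /=; rewrite modzDml addNr. Qed.

HB.instance Definition _ := GRing.isZmodule.Build padic_int
  padic_addA padic_addC padic_add0 padic_addN.

Lemma padic_mulA : associative padic_mul.
Proof. by move=> x y z; apply: padic_intP => k /=; rewrite modzMmr modzMml mulrA. Qed.
Lemma padic_mulC : commutative padic_mul.
Proof. by move=> x y; apply: padic_intP => k /=; rewrite mulrC. Qed.
Lemma padic_mul1 : left_id (padic_const 1) padic_mul.
Proof. by move=> x; apply: padic_intP => k /=; rewrite modzMml mul1r residue_mod. Qed.
Lemma padic_mulDl : left_distributive padic_mul padic_add.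
Proof.
by move=> x y z; apply: padic_intP => k /=; rewrite modzMml modzDm mulrDl.
Qed.

HB.instance Definition _ := GRing.Zmodule_isComPzRing.Build padic_int
  padic_mulA padic_mulC padic_mul1 padic_mulDl.

Lemma residueB (x y : padic_int) k : (x - y) k = ((x k - y k) %% p%:Z ^+ k)%Z.
Proof. by rewrite /= modzDmr. Qed.

Lemma residue_int (m : int) k : (m%:~R : padic_int) k = (m %% p%:Z ^+ k)%Z.
Proof.
suff nat_case (n : nat) : (n%:R : padic_int) k = (n%:Z %% p%:Z ^+ k)%Z.
  case: m => n; first by rewrite -pmulrn nat_case.
  rewrite NegzE mulrNz -pmulrn /= nat_case; apply/eqP.
  by rewrite eqz_mod_dvd opprK addrC -eqz_mod_dvd modz_mod.
elim: n => [|n IHn] //; rewrite -[n.+1]addn1 natrD.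
by rewrite [LHS]/= IHn modzDm PoszD.
Qed.

(* |x|_p = p^-v, where v is the greatest k such that x = 0 mod p^k; |0|_p = 0.  *)
Definition padic_abs (x : padic_int) : rat :=
  if pselect (exists k, x k.+1 != 0) is left x_neq0 then p%:R ^- ex_minn x_neq0
  else 0.

(* The integer m |m|_p (see [non_p_partE]). *)
Definition non_p_part (m : int) : int := numq (m%:~R * padic_abs m%:~R).

Lemma padic_abs_int (m : int) : prime p ->
  padic_abs m%:~R = if m == 0 then 0 else p%:R ^- logn p `|m|%N.
Proof.
move=> p_pr; rewrite /padic_abs.
have resP k : ((m%:~R : padic_int) k != 0) = ~~ (p ^ k %| `|m|)%N.
  by rewrite residue_int (sameP eqP dvdz_mod0P) dvdzE abszX.
case: pselect => [ex|nex]; case: eqVneq => [m0|m_neq0] //.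
- by exfalso; case: ex => k; rewrite resP m0 dvdn0.
- have m_gt0 : (0 < `|m|)%N by rewrite absz_gt0.
  case: ex_minnP => v; rewrite resP pfactor_dvdn // -ltnNge ltnS => le_v min_v.
  congr (_ ^- _); apply/eqP; rewrite eqn_leq le_v andbT min_v //.
  by rewrite resP pfactor_dvdn // ltnn.
case: nex; exists (logn p `|m|).
by rewrite resP pfactor_dvdn ?ltnn // absz_gt0.
Qed.

Lemma non_p_partE (m : int) : prime p ->
  (non_p_part m)%:~R = m%:~R * padic_abs m%:~R.
Proof.
move=> p_pr; rewrite /non_p_part.
suff [z ->] : exists z : int, m%:~R * padic_abs m%:~R = z%:~R by rewrite numq_int.
rewrite padic_abs_int //; case: eqVneq => [_|m_neq0]; first by exists 0; rewrite mulr0.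
set v := logn _ _; exists (m %/ (p ^ v)%N)%Z.
have dv : ((p ^ v)%N %| m)%Z by rewrite dvdzE pfactor_dvdnn.
rewrite -{1}(divzK dv) rmorphM /= -pmulrn natrX mulfK //.
by rewrite expf_neq0 // pnatr_eq0 -lt0n prime_gt0.
Qed.

Lemma residue_eq0_le (x : padic_int) j k : (j <= k)%N -> x k = 0 -> x j = 0.
Proof.
elim: k => [|k IHk]; first by rewrite leqn0 => /eqP->.
rewrite leq_eqVlt => /orP[/eqP-> //|/IHk le_jk xk0]; apply: le_jk.
by rewrite residueP xk0 mod0z.
Qed.

Lemma padic_abs_le (x : padic_int) k : prime p ->
  (padic_abs x <= p%:R ^- k) = (x k == 0).
Proof.
move=> p_pr; have p_gt1 : 1 < p%:R :> rat by rewrite ltr1n prime_gt1.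
have p_gt0 : 0 < p%:R :> rat by apply: lt_trans p_gt1.
have x0 : x 0%N = 0 by rewrite residueP expr0 modz1.
rewrite /padic_abs; case: pselect => [ex|nex].
  case: ex_minnP => v xv min_v.
  rewrite lef_pV2 ?posrE ?exprn_gt0 // ler_eXn2l //.
  apply/idP/eqP => [le_kv|xk0].
    apply: residue_eq0_le le_kv _; case: v min_v {xv} => // v min_v.
    by apply/eqP/contraT => /min_v; rewrite ltnn.
  rewrite leqNgt; apply/negP => lt_vk.
  by rewrite (residue_eq0_le lt_vk xk0) eqxx in xv.
rewrite invr_ge0 exprn_ge0 ?(ltW p_gt0) //; apply/esym/eqP.
by case: k => // k; apply/eqP/contraT => xk; case: nex; exists k.
Qed.

(* Multiple limits in Z_p of integer sequences.  As |.|_p is rational-valued,   *)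
(* rational eps suffice.                                                        *)
Definition mlim (d : nat) (a : ('I_d -> nat) -> int) (alpha : padic_int) : Prop :=
  forall eps : rat, 0 < eps -> exists2 N : nat, (0 < N)%N &
    forall n : 'I_d -> nat, (forall i, N < n i)%N ->
      padic_abs ((a n)%:~R - alpha) < eps.

Lemma mlim_unique (d : nat) (a : ('I_d -> nat) -> int) (alpha beta : padic_int) :
  prime p -> mlim a alpha -> mlim a beta -> alpha = beta.
Proof.
move=> p_pr lim_a lim_b; apply: padic_intP => k.
have e_gt0 : 0 < p%:R ^- k :> rat by rewrite invr_gt0 exprn_gt0 ?ltr0n ?prime_gt0.
have [N1 _ H1] := lim_a _ e_gt0; have [N2 _ H2] := lim_b _ e_gt0.
pose n (_ : 'I_d) := (maxn N1 N2).+1.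
have /ltW := H1 n (fun _ => leq_maxl _ _); have /ltW := H2 n (fun _ => leq_maxr _ _).
rewrite !padic_abs_le // !residueB -!(rwP eqP) => /dvdz_mod0P + /dvdz_mod0P.
rewrite -!eqz_mod_dvd => /eqP eqb /eqP eqa.
by rewrite -[alpha k]residue_mod -[beta k]residue_mod -eqa -eqb.
Qed.

End PadicInt.

(* r_{n_1,...,n_d}(f).  [muni] views f as a polynomial in its last variable t_d *)
(* over Z[t_1,...,t_(d-1)], so the innermost resultant is taken first.          *)
Fixpoint iter_res (p d : nat) : {mpoly int[d]} -> ('I_d -> nat) -> int :=
  match d with
  | 0 => fun f _ => f@_0%MM
  | d'.+1 => fun f n =>
      iter_res p (Res ('X^(p ^ n ord_max) - 1) (muni f))
        (fun i => n (widen_ord (leqnSn d') i))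
  end.

(* Main.v *)
(* Over the complex numbers Res(t^(p^j) - 1, g) is the product u_j of g over the *)
(* p^j-th roots of unity.  For g in Z[t] put q_j = Res(Phi, g), where Phi is the  *)
(* p^(j+1)-th cyclotomic polynomial, so that u_(j+1) = u_j q_j.                   *)
(* - The norm T from Z[t] to Z[t^p] satisfies T g = g mod p and improves a        *)
(*   congruence mod p^a (a > 0) to one mod p^(a+1); as u_(j+1)(g) = u_j(T g),     *)
(*   this gives u_(j+1) = u_j mod p^(j+1).                                        *)
(* - If p divides g(1) then q_j(g) = p q_j(h) for some h, because Phi(1) = p and  *)
(*   Res(Phi, 1 - t) = p; otherwise q_j = 1 mod p^(j+1) by the previous point.    *)
(*   Descending on |q_j|, the non-p-part of q_j is 1 mod p^(j+1) if q_j <> 0.     *)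
(* In several variables, r_n(f) = u_(n_d)(G), where G in Z[t_d] is obtained by    *)
(* eliminating the other variables first, and one inducts on d.  A vanishing      *)
(* r_n(f) divides all later terms, which then vanish too.                         *)

Require Import Defs.
From mathcomp Require Import all_boot all_order all_algebra.
From mathcomp Require Import all_field mpoly zify ring.

Set Implicit Arguments.
Unset Strict Implicit.
Unset Printing Implicit Defensive.

Import Order.TTheory GRing.Theory Num.Theory.
Local Open Scope ring_scope.

(** * Resultants with a split polynomial *)

(** A resultant with X^(p^j) - 1 is a product over roots of unity ([Res_roots], [Res_Xn_sub_1]), so
    the one-variable sequence [norm_pX p j g] gains the factor [Res (cyclo p j) g] at each step
    ([norm_pXS]). The norm from Z[t] to Z[t^p] shifts j by one ([norm_pX_norm_p]), and its
    congruences [norm_p_mod_p] and [norm_p_congr] make consecutive terms agree mod p^(j+1)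
    ([norm_pXS_mod]). [non_p_Res_cyclo] gives the same for the non-p-parts of nonzero terms.

    [iter_res_swap] reduces several variables to one: with all exponents but the last fixed, the
    iterated resultant is some [norm_pX p m G], so exponents can be changed one at a time.
    [mlim_of_mod] turns the resulting congruences into limits. For the zero criterion, each term is
    f(1,...,1) mod p, and when p divides that value every cyclotomic factor contributes a further
    p. *)

Section ResultantRoots.

Variables (R : comNzRingType) (S : idomainType) (phi : {rmorphism R -> S}).

Lemma Sylvester_mxEu (f g : {poly R}) i k :
  Sylvester_mx g f (lshift _ i) k = ('X^i * g)`_k.
Proof. by rewrite col_mxEu mxE mxE /= rVpoly_delta. Qed.

Lemma Sylvester_mxEd (f g : {poly R}) i k :
  Sylvester_mx g f (rshift _ i) k = ('X^i * f)`_k.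
Proof. by rewrite col_mxEd mxE mxE /= rVpoly_delta. Qed.

Lemma horner_coef_map (h : {poly R}) N (x : S) : (size h <= N)%N ->
  \sum_(k < N) phi h`_k * x ^+ k = (map_poly phi h).[x].
Proof.
move=> sh; rewrite (@horner_coef_wide _ N).
  by apply: eq_bigr => k _; rewrite coef_map.
exact: leq_trans (size_poly _ _) sh.
Qed.

Lemma Vandermonde_neq0 (s : seq S) : uniq s ->
  \det (Vandermonde (size s) (\row_(j < size s) s`_j)) != 0.
Proof.
move=> us; rewrite det_Vandermonde; apply/prodf_neq0 => i _.
apply/prodf_neq0 => j ij; rewrite !mxE subr_eq0 nth_uniq //.
by rewrite neq_ltn ij orbT.
Qed.

(* Multiplying the Sylvester matrix by [V 0; * 1], where V is the Vandermonde   *)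
(* matrix of the roots, makes it block triangular.                              *)
Lemma Res_roots (f g : {poly R}) (s : seq S) :
  f \is monic -> uniq s -> size s = (size f).-1 ->
  all (root (map_poly phi f)) s ->
  phi (Res f g) = \prod_(a <- s) (map_poly phi g).[a].
Proof.
move=> mf us ss /allP rs; rewrite /Res /resultant -det_map_mx.
set n := (size g).-1; move: (@Sylvester_mxEu f g) (@Sylvester_mxEd f g).
move: (Sylvester_mx g f); rewrite -/n -ss => M Mu Md.
set m := size s in M Mu Md *; have sfm : size f = m.+1.
  by rewrite /m ss prednK // size_poly_gt0 monic_neq0.
pose a := \row_(j < m) s`_j.
(* The lower left block continues the powers of the roots, so that multiplying a row of coefficients
   by column j < m evaluates a polynomial at the j-th root. *)
pose V := block_mx (Vandermonde m a) 0 (\matrix_(i < n, j < m) a 0 j ^+ (m + i)) 1%:M.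
have detV : \det V = \det (Vandermonde m a) by rewrite det_lblock det1 mulr1.
have VE k (j : 'I_m) : V k (lshift n j) = s`_j ^+ k.
  rewrite -[k]splitK; case: (split k) => k' /=.
    by rewrite block_mxEul !mxE.
  by rewrite block_mxEdl !mxE.
pose D := Vandermonde m a *m diag_mx (\row_j (map_poly phi g).[s`_j]).
have MV : map_mx phi M *m V =
    block_mx D (ursubmx (map_mx phi M *m V)) 0
      (\matrix_(i < n, j < n) phi ('X^i * f)`_(m + j)).
  rewrite -[LHS]submxK; congr block_mx.
  - apply/matrixP => i j; rewrite /D mul_mx_diag !mxE.
    under eq_bigr => k _ do rewrite VE mxE Mu.
    rewrite horner_coef_map; last first.
      rewrite (leq_trans (size_polyMleq _ _)) // size_polyXn addSn.
      rewrite /= (leq_trans (leq_add (leqnn i) (leqSpred (size g)))) // addnS -addSn leq_add2r.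
      exact: ltn_ord.
    by rewrite rmorphM /= map_polyXn hornerM hornerXn.
  - apply/matrixP => i j; rewrite 2!mxE [LHS]mxE mxE.
    under eq_bigr => k _ do rewrite VE mxE Md.
    rewrite horner_coef_map.
      by rewrite rmorphM hornerM (rootP (rs _ (mem_nth 0 (ltn_ord j)))) mulr0.
    rewrite (leq_trans (size_polyMleq _ _)) // size_polyXn sfm addSnnS /= addnC.
    by rewrite addSnnS leq_add2l ltn_ord.
  apply/matrixP => i j; rewrite 2!mxE [LHS]mxE [RHS]mxE.
  rewrite big_split_ord /= big1 ?add0r => [|k _]; last first.
    by rewrite block_mxEur [X in _ * X]mxE mulr0.
  rewrite (bigD1 j) //= big1 ?addr0 => [|k kj]; last first.
    by rewrite block_mxEdr [X in _ * X]mxE (negPf kj) mulr0.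
  by rewrite block_mxEdr !mxE eqxx mulr1 Md.
have := congr1 determinant MV.
rewrite det_mulmx detV det_ublock det_mulmx det_diag.
(* Shifts of the monic [f] read from index m on: triangular with unit diagonal. *)
rewrite (_ : \det (\matrix_(_, _) phi _) = 1); last first.
  rewrite det_trig; last first.
    apply/is_trig_mxP => i j ij; rewrite mxE coefXnM.
    rewrite ltnNge (leq_trans (ltnW ij)) ?leq_addl //= nth_default ?rmorph0 //.
    by rewrite sfm -addnBA ?(ltnW ij) // -addn1 leq_add2l subn_gt0.
  apply: big1 => i _; rewrite mxE coefXnM ltnNge leq_addl /= addnK.
  by have := monicP mf; rewrite lead_coefE sfm /= => ->; rewrite rmorph1.
rewrite mulr1 mulrC => /(mulfI (Vandermonde_neq0 us)) ->.
by rewrite (big_nth 0) big_mkord; apply: eq_bigr => i _; rewrite mxE.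
Qed.

End ResultantRoots.

(** * Cyclotomic polynomials of prime power order and their resultants *)

Section CyclotomicResultants.

Lemma uniq_prim_root_expr (R : nzRingType) n (w : R) (e : seq nat) :
  n.-primitive_root w -> uniq e -> all (ltn^~ n) e -> uniq [seq w ^+ i | i <- e].
Proof.
move=> pw ue /allP le; rewrite map_inj_in_uniq // => i j /le /= li /le /= lj /eqP.
by rewrite (eq_prim_root_expr pw) !modn_small // => /eqP.
Qed.

(** The powers of [w] are n distinct roots of X^n - 1; [phi] lets them live outside the coefficient
    ring. *)
Lemma Res_Xn_sub_1 (R : comNzRingType) (S : idomainType) (phi : {rmorphism R -> S})
    n (w : S) (g : {poly R}) : n.-primitive_root w ->
  phi (Res ('X^n - 1) g) = \prod_(i < n) (map_poly phi g).[w ^+ i].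
Proof.
move=> pw; have n0 := prim_order_gt0 pw.
rewrite (@Res_roots _ _ _ _ _ [seq w ^+ i | i <- index_iota 0 n]).
- by rewrite big_map big_mkord.
- exact: monicXnsubC.
- apply: (uniq_prim_root_expr pw); first exact: iota_uniq.
  by apply/allP => i; rewrite mem_index_iota.
- by rewrite size_map size_iota subn0 size_XnsubC.
apply/allP => _ /mapP[i _ ->]; apply/rootP.
rewrite rmorphB /= map_polyXn rmorph1 !hornerE.
by rewrite exprAC (prim_expr_order pw) expr1n subrr.
Qed.

Lemma Res_X_sub_1 (R : idomainType) (g : {poly R}) : Res ('X^1 - 1) g = g.[1].
Proof.
rewrite -[LHS]/(idfun _) (@Res_roots _ _ idfun _ _ [:: 1]) ?size_XnsubC ?monicXnsubC //.
  by rewrite big_seq1 map_poly_id.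
by rewrite /= andbT map_poly_id //; apply/rootP; rewrite !hornerE subrr.
Qed.

Variable p : nat.
Hypothesis p_pr : prime p.

(* The [p ^ j.+1]-th cyclotomic polynomial. *)
Definition cyclo (j : nat) : {poly int} := \sum_(i < p) 'X^(p ^ j) ^+ i.
Definition cyclo_exps (j : nat) : seq nat :=
  [seq k <- index_iota 0 (p ^ j.+1) | coprime (p ^ j.+1) k].

Let p_gt0 : (0 < p)%N := prime_gt0 p_pr.
Let pX_gt0 j : (0 < p ^ j)%N. Proof. by rewrite expn_gt0 p_gt0. Qed.

Lemma cycloE j : ('X^(p ^ j) - 1) * cyclo j = 'X^(p ^ j.+1) - 1.
Proof. by rewrite -subrX1 -exprM expnSr. Qed.

Lemma cyclo_monic j : cyclo j \is monic.
Proof.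
have := congr1 lead_coef (cycloE j); rewrite mulrC lead_coef_Mmonic ?monicXnsubC //.
by move=> E; rewrite monicE E -monicE monicXnsubC // pX_gt0.
Qed.

Lemma size_cyclo j : size (cyclo j) = (p ^ j.+1 - p ^ j).+1.
Proof.
have sX k : size ('X^(p ^ k) - 1 : {poly int}) = (p ^ k).+1 by exact: size_XnsubC.
have := congr1 (fun q : {poly int} => size q) (cycloE j).
rewrite size_Mmonic ?cyclo_monic ?monic_neq0 ?monicXnsubC // !sX.
rewrite addSn /= => E; have : size (cyclo j) != 0%N.
  by rewrite size_poly_eq0 monic_neq0 ?cyclo_monic.
have le_p : (p ^ j <= p ^ j.+1)%N by rewrite leq_pexp2l.
by move=> nz; move: E le_p nz; move: (p ^ j)%N (p ^ j.+1)%N (size _); lia.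
Qed.

Lemma cyclo1 j : (cyclo j).[1] = p%:Z.
Proof.
rewrite horner_sum (eq_bigr (fun=> 1)) => [|i _]; last by rewrite !hornerE !expr1n.
by rewrite sumr_const card_ord -[RHS]intz pmulrn.
Qed.

Lemma size_cyclo_exps j : size (cyclo_exps j) = (p ^ j.+1 - p ^ j)%N.
Proof.
rewrite size_filter -sumn_count sumnE big_map.
rewrite -totient_count_coprime.
by rewrite totient_pfactor //= -subn1 mulnBl mul1n expnS.
Qed.

Variables (j : nat) (z : algC).
Hypothesis z_prim : (p ^ j.+1).-primitive_root z.

Lemma cyclo_root k : k \in cyclo_exps j -> root (map_poly intr (cyclo j)) (z ^+ k).
Proof.
rewrite mem_filter => /andP[ck _].
have := congr1 (fun q : {poly int} => (map_poly intr q : {poly algC}).[z ^+ k]) (cycloE j).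
rewrite rmorphM rmorphB rmorphB /= !map_polyXn rmorph1 hornerM !hornerE.
rewrite -[RHS]/(_ - _) [in RHS]exprAC (prim_expr_order z_prim) expr1n subrr.
move/eqP; rewrite mulf_eq0 subr_eq0 -exprM -(prim_order_dvd z_prim) => /orP[|//].
  by rewrite Gauss_dvdr // dvdn_Pexp2l ?prime_gt1 // ltnn.
Qed.

Lemma uniq_cyclo_roots : uniq [seq z ^+ k | k <- cyclo_exps j].
Proof.
apply: (uniq_prim_root_expr z_prim); first exact/filter_uniq/iota_uniq.
by apply/allP => k; rewrite mem_filter mem_index_iota => /andP[].
Qed.

Lemma Res_cyclo (g : {poly int}) :
  (Res (cyclo j) g)%:~R = \prod_(k <- cyclo_exps j) (map_poly intr g).[z ^+ k] :> algC.
Proof.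
rewrite (@Res_roots _ _ intr _ _ [seq z ^+ k | k <- cyclo_exps j]).
- by rewrite big_map.
- exact: cyclo_monic.
- exact: uniq_cyclo_roots.
- by rewrite size_map size_cyclo_exps size_cyclo.
by apply/allP => _ /mapP[k jk ->]; apply: cyclo_root.
Qed.

(** Evaluates the factorization of [cyclo] at 1. It serves both as the resultant of [cyclo] with 1 -
    X and to exhibit p as a multiple of 1 - w in [norm_p_mod_p]. *)
Lemma prod_1subX_cyclo : \prod_(k <- cyclo_exps j) (1 - z ^+ k) = p%:R :> algC.
Proof.
have monic_c : (map_poly intr (cyclo j) : {poly algC}) \is monic.
  exact/monic_map/cyclo_monic.
have E : map_poly intr (cyclo j) = \prod_(a <- [seq z ^+ k | k <- cyclo_exps j]) ('X - a%:P).
  rewrite [LHS](@all_roots_prod_XsubC _ _ [seq z ^+ k | k <- cyclo_exps j]).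
  - by rewrite (monicP monic_c) scale1r.
  - rewrite size_map size_cyclo_exps -size_cyclo size_map_inj_poly ?rmorph0 //.
    exact: intr_inj.
  - by apply/allP => _ /mapP[k jk ->]; apply: cyclo_root.
  by rewrite uniq_rootsE uniq_cyclo_roots.
have := congr1 (fun q : {poly algC} => q.[1]) E.
rewrite horner_prod big_map -[1 in LHS](rmorph1 intr) horner_map cyclo1 /= pmulrn => ->.
by apply: eq_bigr => k _; rewrite !hornerE.
Qed.

End CyclotomicResultants.

(** * Prime power roots of unity, one variable *)

Section PrimePowerResultants.

Variable p : nat.
Hypothesis p_pr : prime p.

Let p_gt0 : (0 < p)%N := prime_gt0 p_pr.
Let pX_gt0 j : (0 < p ^ j)%N. Proof. by rewrite expn_gt0 p_gt0. Qed.

Definition norm_pX (j : nat) (g : {poly int}) : int := Res ('X^(p ^ j) - 1) g.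

(** A p^(j+1)-th root of unity is either primitive, hence a root of [cyclo p j], or a p^j-th root of
    unity. *)
Lemma norm_pXS j g : norm_pX j.+1 g = norm_pX j g * Res (cyclo p j) g.
Proof.
apply: (@intr_inj algC); rewrite rmorphM /=.
have [z pz] := C_prim_root_exists (pX_gt0 j.+1).
rewrite (Res_cyclo p_pr pz) (Res_Xn_sub_1 _ _ pz).
rewrite -(big_mkord xpredT (fun i => (map_poly intr g).[z ^+ i])).
rewrite (bigID (coprime (p ^ j.+1))) /= mulrC -big_filter -/(cyclo_exps p j).
congr (_ * _); last by rewrite -big_filter.
pose s := [seq k <- index_iota 0 (p ^ j.+1) | ~~ coprime (p ^ j.+1) k].
rewrite -/s (@Res_roots _ _ intr _ _ [seq z ^+ i | i <- s]).
- by rewrite [RHS]big_map.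

- exact: monicXnsubC (pX_gt0 j).
- apply: (uniq_prim_root_expr pz); first exact/filter_uniq/iota_uniq.
  by apply/allP => k; rewrite mem_filter mem_index_iota => /andP[].
- have := count_predC (coprime (p ^ j.+1)) (index_iota 0 (p ^ j.+1)).
  rewrite -!size_filter size_cyclo_exps // size_iota subn0 size_map size_XnsubC //= ?pX_gt0 //.
  have : (p ^ j <= p ^ j.+1)%N by rewrite leq_pexp2l.
  rewrite -/s; lia.
apply/allP => _ /mapP[k /[!mem_filter]/andP[nck _] ->]; apply/rootP.
rewrite rmorphB /= map_polyXn rmorph1 !hornerE -exprM.
apply/eqP; rewrite subr_eq0 -(prim_order_dvd pz) expnS dvdn_mul //.
by move: nck; rewrite coprime_pexpl // prime_coprime // negbK.
Qed.

(* Modulo [cyclo p j], whose value at 1 is p, a polynomial [g] with [p] dividing *)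
(* [g(1)] is a multiple of [1 - X], and the resultant of [1 - X] is p.           *)
Lemma Res_cyclo_dvd j (g : {poly int}) : (p %| g.[1])%Z ->
  exists h, Res (cyclo p j) g = p%:Z * Res (cyclo p j) h.
Proof.
case/dvdzP=> c gc; have [z pz] := C_prim_root_exists (pX_gt0 j.+1).
(* Both [g] and c times [cyclo] take the value c p at 1; the subtraction leaves the values at
   primitive roots unchanged. *)
have /factor_theorem[h gh] : root (g - c%:P * cyclo p j) 1.
  by apply/rootP; rewrite !hornerE cyclo1 gc subrr.
exists (- h); apply: (@intr_inj algC); rewrite rmorphM /= -pmulrn.
rewrite !(Res_cyclo p_pr pz) -(prod_1subX_cyclo p_pr pz) -big_split /=.
apply: eq_big_seq => k jk.
have := congr1 (fun q : {poly int} => (map_poly intr q : {poly algC}).[z ^+ k]) gh.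
rewrite rmorphB !rmorphM /= hornerD hornerN !hornerM.
rewrite (rootP (cyclo_root p_pr pz jk)) mulr0 subr0 => ->.
by rewrite rmorphN rmorphB /= map_polyX rmorph1 !hornerE; ring.
Qed.

(** * The norm from Z[t] to Z[t^p] and its congruences *)

Lemma dvdz_Aint (m n : int) (x : algC) : m != 0 -> x \in Aint ->
  n%:~R = m%:~R * x -> (m %| n)%Z.
Proof.
move=> m0 Ax nE; have m0' : m%:~R != 0 :> algC by rewrite intr_eq0.
have xE : x = n%:~R / m%:~R by rewrite nE mulrAC mulfV ?mul1r.
(* A rational algebraic integer is an integer. *)
have /intrP[k kE] : x \in Num.int.
  by apply: Cint_rat_Aint => //; rewrite xE rpred_div // rpred_int.
by apply/dvdzP; exists k; apply: (@intr_inj algC); rewrite nE kE rmorphM mulrC.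
Qed.

Lemma Fp_poly_expp (q : {poly 'F_p}) : q ^+ p = q \Po 'X^p.
Proof.
have chp : p \in [char {poly 'F_p}] by rewrite pchar_poly pchar_Fp.
elim/poly_ind: q => [|q c IHq]; first by rewrite comp_poly0 expr0n gtn_eqF.
rewrite exprDn_pchar ?pnatE // exprMn IHq comp_polyD comp_polyM comp_polyX comp_polyC.
by have := expf_card c; rewrite -rmorphXn /= card_Fp // => ->.
Qed.

Lemma int_poly_expp (g : {poly int}) :
  g ^+ p - (g \Po 'X^p) \is a polyOver (dvdz p).
Proof.
have E0 : map_poly intr (g ^+ p - (g \Po 'X^p)) = 0 :> {poly 'F_p}.
  by rewrite rmorphB rmorphXn /= map_comp_poly map_polyXn Fp_poly_expp subrr.
apply/polyOverP => i; have := congr1 (fun q : {poly 'F_p} => q`_i) E0.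
by rewrite coef_map coef0 (dvdz_pcharf (pchar_Fp p_pr)) => /= ->.
Qed.


(** First-order expansion in [c] with integral remainder, used over the algebraic integers with c =
    1 - w and with c = p^a. *)
Lemma prod_add_scaled (A : comNzRingType) (Q : subringClosed A) (I : eqType)
    (r : seq I) (x y : I -> {poly A}) (c : {poly A}) :
  uniq r -> (forall i, x i \is a polyOver Q) ->
  (forall i, y i \is a polyOver Q) -> c \is a polyOver Q ->
  exists2 w, w \is a polyOver Q &
    \prod_(i <- r) (x i + c * y i) = \prod_(i <- r) x i +
      c * (\sum_(i <- r) y i * \prod_(k <- r | k != i) x k) + c ^+ 2 * w.
Proof.
move=> ur xQ yQ cQ; elim: r ur => [_|a r IHr /= /andP[ar ur]].
  by exists 0; rewrite ?rpred0 // !big_nil !mulr0 !addr0.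
have [w wQ E] := IHr ur; set s := \sum_(i <- r) _ in E.
have sQ : s \is a polyOver Q.
  by apply: rpred_sum => i _; apply: rpredM => //; apply: rpred_prod.
exists (x a * w + y a * s + c * y a * w).
  by rewrite !(rpredD, rpredM).
have ra : \prod_(k <- r | k != a) x k = \prod_(k <- r) x k.
  rewrite -big_filter (all_filterP _) //.
  by apply/allP => k kr; apply: contraNneq ar => <-.
have sE : \sum_(i <- r) y i * \prod_(k <- a :: r | k != i) x k = x a * s.
  rewrite mulr_sumr; apply: eq_big_seq => i ir.
  by rewrite big_cons ifT 1?mulrCA //; apply: contraNneq ar => ->.
by rewrite !(big_cons _ _ a r) E sE eqxx /= ra; ring.
Qed.

(* The norm from [Z[t]] to [Z[X]], where [X = t^p].                              *)
Definition norm_p (g : {poly int}) : {poly int} :=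
  Res ('X^p - 'X%:P) (map_poly polyC g).

(** Once X^p is substituted for X, the polynomial T^p - X in T has the p roots w^k X, so the norm
    becomes a product of conjugates. *)
Lemma norm_pE (w : algC) (g : {poly int}) : p.-primitive_root w ->
  map_poly intr (norm_p g) \Po 'X^p =
  \prod_(k < p) (map_poly intr g \Po (w ^+ k *: 'X)) :> {poly algC}.
Proof.
move=> pw; pose phi : {rmorphism {poly int} -> {poly algC}} :=
  comp_poly 'X^p \o map_poly intr.
rewrite -[LHS]/(phi (norm_p g)).
rewrite (@Res_roots _ _ _ _ _ [seq w ^+ k *: 'X | k <- index_iota 0 p]).
- rewrite big_map big_mkord; apply: eq_bigr => k _; rewrite /comp_poly.
  congr _.[_]; rewrite -!map_poly_comp; apply: eq_map_poly => c /=.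
  by rewrite map_polyC comp_polyC.
- exact: monicXnsubC.
- rewrite map_inj_in_uniq ?iota_uniq // => i j; rewrite !mem_index_iota /= => ip jp.
  move/(congr1 (fun q : {poly algC} => q`_1)); rewrite !coefZ coefX !mulr1 => /eqP.
  by rewrite (eq_prim_root_expr pw) !modn_small // => /eqP.
- by rewrite size_map size_iota subn0 size_XnsubC.
apply/allP => _ /mapP[k _ ->]; apply/rootP.
rewrite rmorphB /= map_polyXn map_polyC /= map_polyX comp_polyX !hornerE exprZn.
by rewrite exprAC (prim_expr_order pw) expr1n scale1r subrr.
Qed.

Lemma coef_comp_scaleX (A : comNzRingType) (q : {poly A}) (a : A) i :
  (q \Po (a *: 'X))`_i = a ^+ i * q`_i.
Proof.
rewrite coef_comp_poly; have [iq|iq] := ltnP i (size q).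
  rewrite (bigD1 (Ordinal iq)) //= big1 ?addr0 => [|k ki].
    by rewrite exprZn coefZ coefXn eqxx mulr1 mulrC.
  rewrite exprZn coefZ coefXn; case: eqP => [ik|_]; last by rewrite !mulr0.
  by case/eqP: ki; apply/val_inj.
rewrite nth_default // mulr0 big1 // => k _.
rewrite exprZn coefZ coefXn; case: eqP => [ik|_]; last by rewrite !mulr0.
by have := leq_trans (ltn_ord k) iq; rewrite ik ltnn.
Qed.

(** Each p^j-th root of unity is the p-th power of exactly p of the p^(j+1)-th roots of unity. *)
Lemma norm_pX_norm_p j g : norm_pX j (norm_p g) = norm_pX j.+1 g.
Proof.
apply: (@intr_inj algC); have [z pz] := C_prim_root_exists (pX_gt0 j.+1).
have pw : p.-primitive_root (z ^+ (p ^ j)).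
  rewrite -[X in z ^+ X](mulKn _ p_gt0) -expnS.
  by apply: (dvdn_prim_root pz); rewrite expnS dvdn_mulr.
have pz' : (p ^ j).-primitive_root (z ^+ p).
  rewrite -[X in z ^+ X](mulnK p (pX_gt0 j)) -expnS.
  by apply: (dvdn_prim_root pz); rewrite expnS dvdn_mull.
rewrite (Res_Xn_sub_1 _ _ pz') [RHS](Res_Xn_sub_1 _ _ pz).
rewrite -[RHS](big_mkord xpredT (fun i => (map_poly intr g).[z ^+ i])).
rewrite expnS big_nat_mul /=.
under [RHS]eq_bigr => i _.
  rewrite -[X in \prod_(X <= _ < _) _]add0n big_addn mulSn addnK.
  over.
rewrite exchange_big /= big_mkord; apply: eq_bigr => k _.
have := congr1 (fun q : {poly algC} => q.[z ^+ k]) (norm_pE g pw).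
rewrite horner_comp hornerXn exprAC => ->; rewrite horner_prod big_mkord.
apply: eq_bigr => i _; rewrite horner_comp !hornerE -exprM -exprD.
by rewrite mulnC addnC.
Qed.

Lemma polyOver_Aint_map_intr (f : {poly int}) :
  (map_poly intr f : {poly algC}) \is a polyOver Aint.
Proof. by apply/polyOverP => i; rewrite coef_map Aint_int. Qed.

Lemma polyOver_Aint_scaleX (q : {poly algC}) (a : algC) :
  a \in Aint -> q \is a polyOver Aint -> q \Po (a *: 'X) \is a polyOver Aint.
Proof.
move=> aA qA; apply/polyOverP => i; rewrite coef_comp_scaleX rpredM ?rpredX //.
exact: (polyOverP qA).
Qed.

Lemma coef_norm_p (w : algC) (g : {poly int}) i : p.-primitive_root w ->
  ((norm_p g)`_i)%:~R =
  (\prod_(k < p) (map_poly intr g \Po (w ^+ k *: 'X)))`_(i * p) :> algC.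
Proof.
move=> pw; rewrite -norm_pE // coef_comp_poly_Xn // dvdn_mull // mulnK //.
by rewrite coef_map.
Qed.

(* The conjugates of [g] are congruent modulo [1 - w], hence [norm_p g] is        *)
(* congruent to [g ^+ p]; an integer divisible by [1 - w] is divisible by [p].    *)
Lemma norm_p_mod_p (g : {poly int}) : norm_p g - g \is a polyOver (dvdz p).
Proof.
apply/polyOverP => i; have [w pw] := C_prim_root_exists p_gt0.
have wA : w \in Aint by apply: Aint_prim_root pw.
pose G : {poly algC} := map_poly intr g.
(* The quotient of G(w^k X) - G by 1 - w, from the geometric sum for w^(k m) - 1. *)
pose E k := \poly_(m < size g) (- (\sum_(l < k * m) w ^+ l) * G`_m).
have GE k : G \Po (w ^+ k *: 'X) = G + (1 - w)%:P * E k.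
  apply/polyP => m; rewrite coef_comp_scaleX coefD coefCM [(E k)`_m]coef_poly -exprM.
  case: ltnP => [_|ms]; last by rewrite /G coef_map nth_default //= !mulr0 addr0.
  by rewrite -[w ^+ _](subrK 1) subrX1; ring.
have EA k : E k \is a polyOver Aint.
  apply: polyOver_poly => m _; rewrite rpredM ?rpredN ?rpred_sum // => [l _|].
    exact: rpredX.
  exact: (polyOverP (polyOver_Aint_map_intr g)).
have uA : (1 - w)%:P \is a polyOver Aint by rewrite polyOverC rpredB ?rpred1.
have [W WA prodE] := @prod_add_scaled _ Aint _ (index_iota 0 p)
  (fun=> G) E _ (iota_uniq _ _) (fun=> polyOver_Aint_map_intr g) EA uA.
have /polyOver_dvdzP[e ge] := int_poly_expp g.
have pw1 : (p ^ 1).-primitive_root w by rewrite expn1.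
have := prod_1subX_cyclo p_pr pw1; set r := cyclo_exps p 0 => prodr.
have [x xA px] : exists2 x, x \in Aint & p%:R = (1 - w) * x.
  have r1 : 1%N \in r by rewrite mem_filter mem_index_iota coprimen1 expn1 prime_gt1.
  exists (\prod_(k <- r | k != 1%N) (1 - w ^+ k)).
    by apply: rpred_prod => k _; rewrite rpredB ?rpred1 ?rpredX.
  by rewrite -prodr (bigD1_seq 1%N) ?filter_uniq ?iota_uniq.
have [y yA ny] : exists2 y, y \in Aint & ((norm_p g - g)`_i)%:~R = (1 - w) * y.
  set s := \sum_(k <- _) _ in prodE.
  have sA : s \is a polyOver Aint.
    apply: rpred_sum => k _; apply: rpredM => //; apply: rpred_prod => l _.
    exact: polyOver_Aint_map_intr.
  exists (x * (e`_(i * p))%:~R + s`_(i * p) + (1 - w) * W`_(i * p)).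
    apply: rpredD; last by rewrite rpredM ?rpredB ?rpred1 //; exact: (polyOverP WA).
    by apply: rpredD; [rewrite rpredM ?Aint_int | exact: (polyOverP sA)].
  rewrite coefB rmorphB /= (coef_norm_p _ _ pw).
  under eq_bigr => k _ do rewrite -/G GE.
  rewrite -(big_mkord xpredT (fun k => G + (1 - w)%:P * E k)) prodE.
  rewrite prodr_const_nat subn0 !coefD expr2 -mulrA !coefCM -rmorphXn.
  rewrite (_ : g ^+ p = (g \Po 'X^p) + p%:Z *: e); last by rewrite -ge addrC subrK.
  rewrite coef_map coefD coefZ coef_comp_poly_Xn // dvdn_mull // mulnK //.
  by rewrite /= rmorphD rmorphM /= -pmulrn px; ring.
(* Pair the p - 1 factors n with the factors 1 - w^k of p. The quotients are integral: [w] is a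
   power of w^k, so 1 - w is a multiple of 1 - w^k. *)
have [v vA nv] : exists2 v, v \in Aint & ((norm_p g - g)`_i ^+ p.-1)%:~R = p%:~R * v.
  set n := _`_i in ny *.
  have nz k : k \in r -> 1 - w ^+ k != 0.
    rewrite mem_filter expn1 => /andP[ck _]; rewrite subr_eq0 eq_sym -(prim_order_dvd pw).
    by rewrite -prime_coprime.
  exists (\prod_(k <- r) (n%:~R / (1 - w ^+ k))).
    rewrite big_seq; apply: rpred_prod => k kr.
    have := kr; rewrite mem_filter expn1 coprime_sym => /andP[ck _].
    have pwk : p.-primitive_root (w ^+ k) by rewrite prim_root_exp_coprime.
    have [l wl] := prim_rootP pwk (prim_expr_order pw).
    rewrite ny (_ : 1 - w = (1 - w ^+ k) * \sum_(i < l) (w ^+ k) ^+ i).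
      rewrite -[_ * _ * y]mulrA mulrC mulKf ?nz //.
      by rewrite rpredM // rpred_sum // => m _; rewrite !rpredX.
    by rewrite {1}wl -opprB subrX1 -mulNr opprB.
  rewrite -[p%:~R]pmulrn -prodr -big_split /= (eq_big_seq (fun=> n%:~R)) => [|k kr].
    rewrite big_const_seq count_predT size_cyclo_exps // expn1 expn0 subn1.
    by rewrite -Monoid.iteropE rmorphXn.
  by rewrite mulrC divfK // nz.
have := dvdz_Aint _ vA nv.
rewrite dvdzE abszX Euclid_dvdX // -dvdzE => /(_ _)/andP[] //.
by rewrite eqz_nat gtn_eqF.
Qed.

(* The part of [norm_p (g + p ^ a e)] linear in [e] is [p ^ a] times a trace,      *)
(* and the trace of [t ^ k] is [p t ^ k] or 0.                                     *)
Lemma norm_p_congr a (g h : {poly int}) : (0 < a)%N ->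
  h - g \is a polyOver (dvdz (p ^ a)%N) ->
  norm_p h - norm_p g \is a polyOver (dvdz (p ^ a.+1)%N).
Proof.
move=> a0 /polyOver_dvdzP[e he]; apply/polyOverP => i.
have [w pw] := C_prim_root_exists p_gt0.
have wA : w \in Aint by apply: Aint_prim_root pw.
(* In this form the index type is the group Z/p, so products over conjugates can be reindexed by
   translation. *)
have [n pE] : exists n, p = n.+2 by case: (p) (prime_gt1 p_pr) => [|[|n]] // _; exists n.
pose G : {poly algC} := map_poly intr g; pose E : {poly algC} := map_poly intr e.
have pw' : n.+2.-primitive_root w by rewrite -pE.
pose sc (k : 'I_n.+2) : {poly algC} := w ^+ k *: 'X.
have scA k (q : {poly int}) : map_poly intr q \Po sc k \is a polyOver Aint.
  by rewrite polyOver_Aint_scaleX ?rpredX ?polyOver_Aint_map_intr.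
have scD k l : sc k \Po sc l = sc (k + l).
  by rewrite /sc comp_polyZ comp_polyX scalerA -exprD /= (prim_expr_mod pw').
have cA : ((p ^ a)%:R)%:P \is a polyOver Aint by rewrite polyOverC rpred_nat.
have [W WA prodE] := @prod_add_scaled _ Aint _ (index_enum 'I_n.+2)
  (fun k => G \Po sc k) (fun k => E \Po sc k) _ (index_enum_uniq _) (scA^~ g) (scA^~ e) cA.
set s := \sum_(k <- _) _ in prodE.
pose F := E * \prod_(k < n.+2 | k != 0) (G \Po sc k).
have sE : s = \sum_(k < n.+2) (F \Po sc k).
  rewrite /s; apply: eq_bigr => m _; rewrite /F comp_polyM rmorph_prod; congr (_ * _).
  rewrite (reindex_inj (addIr m)) /=; apply: eq_big => l.
    by rewrite -subr_eq0 addrK.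
  by rewrite -comp_polyA scD.
have FA : F \is a polyOver Aint.
  by rewrite rpredM ?polyOver_Aint_map_intr //; apply: rpred_prod => k _; exact: scA.
have sp : s`_(i * p) = p%:R * F`_(i * p).
  rewrite sE coef_sum (eq_bigr (fun=> F`_(i * p))) => [|k _].
    by rewrite sumr_const card_ord -pE mulr_natl.
  rewrite coef_comp_scaleX (_ : _ ^+ _ = 1) ?mul1r //.
  by apply/eqP; rewrite -exprM -(prim_order_dvd pw) mulnA dvdn_mull.
(* The quadratic term p^(2a) W is p^(a+1) times p^(a-1) W, since a > 0. *)
apply: (@dvdz_Aint _ _ (F`_(i * p) + (p ^ a.-1)%:R * W`_(i * p))).
- by rewrite eqz_nat -lt0n pX_gt0.
- apply: rpredD; first exact: (polyOverP FA).
  by rewrite rpredM ?rpred_nat //; exact: (polyOverP WA).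
have prodpE (q : {poly int}) : \prod_(k < p) (map_poly intr q \Po (w ^+ k *: 'X)) =
    \prod_(k < n.+2) (map_poly intr q \Po sc k).
  by rewrite -(big_mkord xpredT (fun k => map_poly intr q \Po (w ^+ k *: 'X))) pE big_mkord.
rewrite coefB rmorphB /= !(coef_norm_p _ _ pw) !prodpE.
rewrite (eq_bigr (fun k : 'I_n.+2 => G \Po sc k + ((p ^ a)%:R)%:P * (E \Po sc k))); last first.
  move=> k _; rewrite (_ : h = g + (p ^ a)%:Z *: e); last by rewrite -he addrC subrK.
  by rewrite rmorphD /= comp_polyD map_polyZ comp_polyZ -mul_polyC.
rewrite prodE !coefD expr2 -mulrA !coefCM sp.
have E2 : (p ^ a.+1)%:R * (p ^ a.-1)%:R = (p ^ a)%:R * (p ^ a)%:R :> algC.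
  by rewrite -!natrM -!expnD; congr (p ^ _)%:R; lia.
have E1 : (p ^ a.+1)%:R = (p ^ a)%:R * p%:R :> algC by rewrite expnSr natrM.
rewrite -[(Posz _)%:~R]pmulrn mulrDr [X in _ = _ + X]mulrA E2 E1 -/G; ring.
Qed.

(** * Congruences for the one-variable sequence and its non-p-parts *)

Lemma norm_pX0 g : norm_pX 0 g = g.[1].
Proof. exact: Res_X_sub_1. Qed.

(** Passing to norms trades one unit of j for one of a, down to j = 0 where values at 1 are
    compared. *)
Lemma norm_pX_congr j a (g h : {poly int}) : (0 < a)%N ->
  h - g \is a polyOver (dvdz (p ^ a)%N) ->
  ((p ^ (a + j))%N %| norm_pX j h - norm_pX j g)%Z.
Proof.
elim: j a g h => [|j IHj] a g h a0 gh; last first.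
  by rewrite -!norm_pX_norm_p addnS -addSn IHj // norm_p_congr.
rewrite !norm_pX0 addn0 -hornerN -hornerD; have /polyOver_dvdzP[e ->] := gh.
by rewrite hornerZ dvdz_mulr.
Qed.

Lemma norm_pXS_mod j g : ((p ^ j.+1)%N %| norm_pX j.+1 g - norm_pX j g)%Z.
Proof. by rewrite -norm_pX_norm_p -add1n norm_pX_congr ?expn1 ?norm_p_mod_p. Qed.

Lemma non_p_partM (a b : int) :
  non_p_part p (a * b) = non_p_part p a * non_p_part p b.
Proof.
apply: (@intr_inj rat); rewrite rmorphM /= !non_p_partE // rmorphM /= mulrACA.
have [->|a0] := eqVneq a 0; first by rewrite !mul0r.
have [->|b0] := eqVneq b 0; first by rewrite !(mul0r, mulr0).
congr (_ * _); rewrite !padic_abs_int // mulf_eq0 (negPf a0) (negPf b0) /=.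
by rewrite abszM lognM ?absz_gt0 // exprD invfM.
Qed.

Lemma non_p_part_id (a : int) : ~~ (p %| a)%Z -> non_p_part p a = a.
Proof.
move=> pa; apply: (@intr_inj rat); rewrite non_p_partE // padic_abs_int //.
case: eqVneq => [a0|a0]; first by rewrite a0 mulr0.
rewrite dvdzE in pa; rewrite (_ : logn _ _ = 0%N) ?expr0 ?invr1 ?mulr1 //.
by apply/eqP; rewrite -leqn0 leqNgt logn_gt0 mem_primes p_pr absz_gt0 a0.
Qed.

Lemma non_p_part_p : non_p_part p p = 1.
Proof.
apply: (@intr_inj rat); rewrite non_p_partE // padic_abs_int //.
rewrite eqz_nat gtn_eqF //= logn_prime // eqxx expr1 divff //.
by rewrite -pmulrn pnatr_eq0 -lt0n.
Qed.

Lemma norm_pX_mod j k g : (j <= k)%N -> ((p ^ j)%N %| norm_pX k g - norm_pX j g)%Z.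
Proof.
move/subnKC <-; elim: (k - j)%N => [|n IHn]; first by rewrite addn0 subrr.
rewrite addnS -[_ - _](subrKA (norm_pX (j + n) g)); apply: rpredD => //.
apply: dvdz_trans (norm_pXS_mod _ _); rewrite dvdzE dvdn_exp2l //; lia.
Qed.

Lemma norm_pX_mod_p j g : (p %| norm_pX j g - g.[1])%Z.
Proof.
rewrite -norm_pX0; case: j => [|j]; first by rewrite subrr.
rewrite -[_ - _](subrKA (norm_pX 1 g)); apply: rpredD.
  by have := @norm_pX_mod 1 j.+1 g isT; rewrite expn1.
by have := norm_pXS_mod 0 g; rewrite expn1.
Qed.

Lemma norm_pX_dvd j k g : (j <= k)%N -> (norm_pX j g %| norm_pX k g)%Z.
Proof.
move/subnKC <-; elim: (k - j)%N => [|n IHn]; first by rewrite addn0.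
by rewrite addnS norm_pXS dvdz_mulr.
Qed.

(** While p divides g(1), a factor p splits off and leaves a smaller nonzero resultant. Once g(1) is
    prime to p, so is [norm_pX j g], which then cancels from [norm_pXS_mod]. *)
Lemma non_p_Res_cyclo j g : Res (cyclo p j) g != 0 ->
  ((p ^ j.+1)%N %| non_p_part p (Res (cyclo p j) g) - 1)%Z.
Proof.
have [n] := ubnP `|Res (cyclo p j) g|%N; elim: n g => // n IHn g.
rewrite ltnS => ltn qg0; have [pg|pg] := boolP (p %| g.[1])%Z.
  have [h qE] := Res_cyclo_dvd j pg; rewrite qE mulf_eq0 negb_or in qg0 *.
  case/andP: qg0 => _ qh0; rewrite non_p_partM non_p_part_p mul1r IHn //.
  rewrite (leq_trans _ ltn) // qE abszM ltn_Pmull ?prime_gt1 // absz_gt0 //.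
have pN : ~~ (p %| norm_pX j g)%Z.
  apply: contra pg => pN; have := norm_pX_mod_p j g.
  by rewrite rpredBl.
have q1 : ((p ^ j.+1)%N %| Res (cyclo p j) g - 1)%Z.
  have := norm_pXS_mod j g; rewrite norm_pXS -[X in _ - X]mulr1 -mulrBr.
  by rewrite Gauss_dvdzr // coprimezE /= coprime_pexpl // prime_coprime.
rewrite non_p_part_id //; apply/negP => pq; have : (p %| 1%R)%Z.
  rewrite -[1](subKr (Res (cyclo p j) g)); apply: rpredB => //.
  by apply: dvdz_trans q1; rewrite dvdzE /= dvdn_exp.
by rewrite dvdzE dvdn1 gtn_eqF ?prime_gt1.
Qed.

Lemma norm_pX_non_p_mod j k g : (j <= k)%N -> norm_pX k g != 0 ->
  ((p ^ j)%N %| non_p_part p (norm_pX k g) - non_p_part p (norm_pX j g))%Z.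
Proof.
move/subnKC <-; elim: (k - j)%N => [|n IHn]; first by rewrite addn0 subrr.
rewrite addnS norm_pXS mulf_eq0 negb_or => /andP[/IHn uE q0].
rewrite -[_ - _](subrKA (non_p_part p (norm_pX (j + n) g))); apply: rpredD => //.
rewrite non_p_partM -[X in _ - X]mulr1 -mulrBr dvdz_mull //.
apply: dvdz_trans (non_p_Res_cyclo q0); rewrite dvdzE dvdn_exp2l //; lia.
Qed.

Lemma norm_pX_dvd_pX j g : (p %| g.[1])%Z -> ((p ^ j)%N %| norm_pX j g)%Z.
Proof.
move=> pg; elim: j => [|j IHj]; first by rewrite expn0 dvd1z.
have [h qE] := Res_cyclo_dvd j pg.
by rewrite norm_pXS qE expnSr PoszM dvdz_mul // dvdz_mulr.
Qed.
End PrimePowerResultants.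

(** * Several variables *)

Section IteratedResultants.

Lemma mnm_rcons_max d (m : 'X_{1..d}) k : [multinom of rcons m k] ord_max = k.
Proof. by rewrite (mnm_nth 0) /= nth_rcons size_tuple ltnn eqxx. Qed.

Lemma mnm_rcons_widen d (m : 'X_{1..d}) k i :
  [multinom of rcons m k] (widen_ord (leqnSn d) i) = m i.
Proof. by rewrite !(mnm_nth 0) /= nth_rcons size_tuple ltn_ord. Qed.

Lemma mcoeff_muni (R : nzRingType) d (f : {mpoly R[d.+1]}) k (m : 'X_{1..d}) :
  (muni f)`_k@_m = f@_[multinom of rcons m k].
Proof.
rewrite muniE coef_sum raddf_sum [in RHS](mpolyE f) raddf_sum /=.
apply: eq_bigr => u _; rewrite coefZ coefXn mcoeffZ mcoeffX.
rewrite -scalerAl mcoeffZ; congr (_ * _).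
have [->|ku] := eqVneq k (u ord_max); last first.
  by rewrite mulr0 mcoeff0; case: eqP => // uE; rewrite uE mnm_rcons_max eqxx in ku.
rewrite mulr1 mcoeffX; congr (_ %:R); congr nat_of_bool.
apply/eqP/eqP => [/mnmP e|ue].
  apply/mnmP => i; case: (unliftP ord_max i) => [j ->|->].
    rewrite (_ : lift ord_max j = widen_ord (leqnSn d) j).
      by rewrite mnm_rcons_widen -e mnmE.
    by apply/val_inj; exact: lift_max.
  by rewrite mnm_rcons_max.
by apply/mnmP => i; rewrite mnmE ue mnm_rcons_widen.
Qed.

Lemma map_mpoly_muni (R S : comNzRingType) (phi : {rmorphism R -> S}) d
    (f : {mpoly R[d.+1]}) :
  map_poly (map_mpoly phi) (muni f) = muni (map_mpoly phi f).
Proof.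
apply/polyP => k; apply/mpolyP => m.
by rewrite coef_map mcoeff_muni !mcoeff_map_mpoly mcoeff_muni.
Qed.

Lemma meval_muni (R : comNzRingType) d (f : {mpoly R[d.+1]}) :
  (muni f).[1].@[fun=> 1] = f.@[fun=> 1].
Proof.
rewrite muniE horner_sum raddf_sum mevalE; apply: eq_bigr => m _.
rewrite hornerZ hornerXn expr1n mulr1 /= mevalZ mevalX.
by rewrite !big1 // => i _; rewrite expr1n.
Qed.

Variable p : nat.
Hypothesis p_pr : prime p.

(** General coefficients are needed for algC, where iterated resultants are multiplicative, and for
    Z[t], where one variable is kept as a parameter. *)
Fixpoint iter_res_over (R : comNzRingType) (d : nat) :
    {mpoly R[d]} -> ('I_d -> nat) -> R :=
  match d with
  | 0 => fun f _ => f@_0%MM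
  | d'.+1 => fun f n =>
      iter_res_over (Res ('X^(p ^ n ord_max) - 1) (muni f))
        (fun i => n (widen_ord (leqnSn d') i))
  end.

Lemma iter_res_overE d (f : {mpoly int[d]}) n : iter_res p f n = iter_res_over f n.
Proof. by elim: d f n => //= d IHd f n; rewrite IHd. Qed.

Section ToAlgC.

Variables (d N : nat) (z : algC).
Hypothesis z_prim : N.-primitive_root z.

Lemma mpolyC_prim_root : N.-primitive_root (z%:MP : {mpoly algC[d]}).
Proof. by rewrite fmorph_primitive_root. Qed.

Lemma Res_map_mpoly (R : comNzRingType) (phi : {rmorphism R -> algC})
    (F : {poly {mpoly R[d]}}) :
  map_mpoly phi (Res ('X^N - 1) F) =
  \prod_(i < N) (map_poly (map_mpoly phi) F).[z%:MP ^+ i].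
Proof. exact: (Res_Xn_sub_1 (map_mpoly phi) _ mpolyC_prim_root). Qed.

Lemma Res_mpoly_algC (F : {poly {mpoly algC[d]}}) :
  Res ('X^N - 1) F = \prod_(i < N) F.[z%:MP ^+ i].
Proof.
by have := Res_Xn_sub_1 idfun F mpolyC_prim_root; rewrite map_poly_id.
Qed.

Lemma Res_mpoly_algCM (F G : {poly {mpoly algC[d]}}) :
  Res ('X^N - 1) (F * G) = Res ('X^N - 1) F * Res ('X^N - 1) G.
Proof.
rewrite !Res_mpoly_algC -big_split /=; apply: eq_bigr => i _.
exact: hornerM.
Qed.

End ToAlgC.

Let pX_gt0 j : (0 < p ^ j)%N. Proof. by rewrite expn_gt0 prime_gt0. Qed.

Lemma iter_res_over_map (R : comNzRingType) (phi : {rmorphism R -> algC}) d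
    (f : {mpoly R[d]}) n :
  phi (iter_res_over f n) = iter_res_over (map_mpoly phi f) n.
Proof.
elim: d f n => [|d IHd] f n /=; first by rewrite mcoeff_map_mpoly.
have [z pz] := C_prim_root_exists (pX_gt0 (n ord_max)).
by rewrite IHd (Res_map_mpoly pz) (Res_mpoly_algC pz) map_mpoly_muni.
Qed.

Lemma iter_res_over1 d n : iter_res_over (1 : {mpoly algC[d]}) n = 1.
Proof.
elim: d n => [|d IHd] n /=; first by rewrite mcoeff1 eqxx.
have [z pz] := C_prim_root_exists (pX_gt0 (n ord_max)).
rewrite muni1 (Res_mpoly_algC pz) big1 => [|i _]; first exact: IHd.
by rewrite hornerC.
Qed.

Lemma iter_res_overM d (f g : {mpoly algC[d]}) n :
  iter_res_over (f * g) n = iter_res_over f n * iter_res_over g n.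
Proof.
elim: d f g n => [|d IHd] f g n /=; first by rewrite (mcoeff0_is_multiplicative _ _).
have [z pz] := C_prim_root_exists (pX_gt0 (n ord_max)).
rewrite -IHd; congr iter_res_over.
have -> : muni (f * g) = muni f * muni g by exact: muniM.
exact: (Res_mpoly_algCM pz).
Qed.

(* The resultant in the last variable may be taken last instead of first. *)
Lemma iter_res_swap d (F : {poly {mpoly int[d]}}) (n : 'I_d -> nat) :
  exists G : {poly int}, forall m,
    iter_res p (Res ('X^(p ^ m) - 1) F) n = norm_pX p m G.
Proof.
(* The last variable becomes a parameter in the coefficients and the others are eliminated over it;
   nothing here depends on m. *)
exists (iter_res_over (map_poly (map_mpoly polyC) F).[('X)%:MP] n) => m.
apply: (@intr_inj algC); have [z pz] := C_prim_root_exists (pX_gt0 m).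
rewrite iter_res_overE (iter_res_over_map intr) (Res_map_mpoly pz).
rewrite (Res_Xn_sub_1 _ _ pz).
(* Multiplicativity brings the elimination inside the product over roots of unity; the factor at z^i
   is [G] specialized there. *)
rewrite (big_morph _ (fun f g => iter_res_overM f g n) (iter_res_over1 n)).
apply: eq_bigr => i _.
pose psi : {rmorphism {poly int} -> algC} := horner_eval (z ^+ i) \o map_poly intr.
rewrite -[RHS]/(psi (iter_res_over _ n)) iter_res_over_map.
congr (iter_res_over _ n).
rewrite -(horner_map (map_mpoly psi)) /= map_mpolyC.
have psiX : psi 'X = z ^+ i by rewrite /psi /= map_polyX /horner_eval hornerX.
congr _.[_]; last by rewrite -[X in _ = X%:MP]/(psi 'X) psiX rmorphXn.
apply/polyP => k; rewrite !coef_map /=; apply/mpolyP => u.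
by rewrite !mcoeff_map_mpoly /= map_polyC /horner_eval hornerC.
Qed.

(** * Congruences and divisibility in several variables, and passage to the limit *)

Lemma iter_resS d (f : {mpoly int[d.+1]}) n :
  iter_res p f n = iter_res p (Res ('X^(p ^ n ord_max) - 1) (muni f))
    (fun i => n (widen_ord (leqnSn d) i)).
Proof. by []. Qed.

Lemma iter_res_mod d (f : {mpoly int[d]}) n n' N :
    (forall i, N <= n i)%N -> (forall i, N <= n' i)%N ->
  ((p ^ N)%N %| iter_res p f n - iter_res p f n')%Z.
Proof.
elim: d f n n' => [|d IHd] f n n' Nn Nn'; first by rewrite subrr.
rewrite !iter_resS; set h := fun i => n _; set h' := fun i => n' _.
(* The intermediate term keeps the last exponent of [n] and takes the others from [n']. *)
rewrite -[_ - _](subrKA (iter_res p (Res ('X^(p ^ n ord_max) - 1) (muni f)) h')).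
apply: rpredD; first by apply: IHd => i; [exact: Nn | exact: Nn'].
have [G GE] := iter_res_swap (muni f) h'; rewrite !GE.
rewrite -[_ - _](subrKA (norm_pX p N G)); apply: rpredD; first exact: norm_pX_mod.
by rewrite -opprB rpredN norm_pX_mod.
Qed.

Lemma iter_res_dvd d (f : {mpoly int[d]}) n n' : (forall i, n i <= n' i)%N ->
  (iter_res p f n %| iter_res p f n')%Z.
Proof.
elim: d f n n' => [|d IHd] f n n' nn'; first exact: dvdzz.
rewrite !iter_resS; set h' := fun i => n' _.
apply: (@dvdz_trans (iter_res p (Res ('X^(p ^ n ord_max) - 1) (muni f)) h')).
  by apply: IHd => i; exact: nn'.
by have [G GE] := iter_res_swap (muni f) h'; rewrite !GE norm_pX_dvd.
Qed.

Lemma iter_res_non_p_mod d (f : {mpoly int[d]}) n n' N :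
    (forall i, N <= n i)%N -> (forall i, n i <= n' i)%N -> iter_res p f n' != 0 ->
  ((p ^ N)%N %| non_p_part p (iter_res p f n') - non_p_part p (iter_res p f n))%Z.
Proof.
elim: d f n n' => [|d IHd] f n n' Nn nn'; first by rewrite subrr.
rewrite !iter_resS; set h := fun i => n _; set h' := fun i => n' _.
have [G GE] := iter_res_swap (muni f) h' => f0.
set u := iter_res p (Res ('X^(p ^ n ord_max) - 1) (muni f)) h'.
rewrite -[_ - _](subrKA (non_p_part p u)); apply: rpredD.
  move: f0; rewrite /u !GE => f0; apply: dvdz_trans (norm_pX_non_p_mod _ _ f0) => //.
  by rewrite dvdzE dvdn_exp2l.
apply: IHd => [i|i|]; [exact: Nn | exact: nn' |].
(* The intermediate term divides the later, nonzero one. *)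
apply: contraNneq f0 => u0; rewrite -dvd0z -u0 /u !GE.
exact: norm_pX_dvd.
Qed.

Lemma iter_res_norm_p0 d (F : {poly {mpoly int[d]}}) n :
  iter_res p (Res ('X^(p ^ 0) - 1) F) n = iter_res p F.[1] n.
Proof. by congr iter_res; exact: Res_X_sub_1. Qed.

Lemma iter_res_mod_p d (f : {mpoly int[d]}) n :
  (p %| iter_res p f n - f.@[fun=> 1])%Z.
Proof.
elim: d f n => [|d IHd] f n.
  have -> : f = (f@_0)%:MP.
    apply/mpolyP => m; rewrite mcoeffC (_ : m = 0%MM) ?eqxx ?mulr1 //.
    by apply/mnmP => -[].
  by rewrite mevalC /= mcoeffC eqxx mulr1 subrr.
rewrite iter_resS; set h := fun i => n _.
rewrite -meval_muni -[_ - _](subrKA (iter_res p (muni f).[1] h)); apply: rpredD => //.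
have [G GE] := iter_res_swap (muni f) h.
by rewrite -iter_res_norm_p0 !GE norm_pX0 norm_pX_mod_p.
Qed.

Lemma iter_res_dvd_pX d (f : {mpoly int[d.+1]}) n : (p %| f.@[fun=> 1])%Z ->
  ((p ^ n ord_max)%N %| iter_res p f n)%Z.
Proof.
move=> pf; rewrite iter_resS; set h := fun i => n _.
have [G GE] := iter_res_swap (muni f) h; rewrite GE norm_pX_dvd_pX //.
(* G(1) is the term of exponent 0, that is, the elimination applied to [f] with last variable 1. *)
rewrite -(norm_pX0 p) -GE iter_res_norm_p0.
have := iter_res_mod_p (muni f).[1] h; rewrite meval_muni.
by rewrite rpredBr.
Qed.

(** The sequence [u] supplies compatible residues, so the limit is built directly in the inverse
    limit. *)
Lemma mlim_of_mod d (a : ('I_d -> nat) -> int) (u : nat -> int) :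
    (forall N n, (forall i, N <= n i)%N -> ((p ^ N)%N %| a n - u N)%Z) ->
  exists alpha : padic_int p, mlim a alpha /\ (forall k, (alpha k = u k %[mod p%:Z ^+ k])%Z).
Proof.
move=> au; have pXE k : p%:Z ^+ k = (p ^ k)%N by rewrite -rmorphXn.
have uS k : (u k.+1 = u k %[mod p%:Z ^+ k])%Z.
  apply/eqP; rewrite eqz_mod_dvd pXE.
  rewrite -[_ - _](subrKA (a (fun=> k.+1))) addrC; apply: rpredD.
    by apply: au => i; exact: leqnSn.
  rewrite -opprB rpredN; apply: dvdz_trans (au k.+1 (fun=> k.+1) (fun=> leqnn _)).
  by rewrite dvdzE dvdn_exp2l.
exists (padic_of uS); split; last by move=> k; rewrite /= modz_mod.
(* This k exceeds 1/eps, hence so does p^k. *)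
move=> eps eps0; pose k := Num.bound eps^-1; exists k.+1 => // n nk.
apply: (@le_lt_trans _ _ (p%:R ^- k)).
  rewrite padic_abs_le // residueB residue_int /= modzDml -modzDmr modzNm modzDmr.
  by apply/eqP/dvdz_mod0P; rewrite pXE; apply: au => i; exact: ltnW (ltnW (nk i)).
rewrite -[eps]invrK ltf_pV2 ?posrE ?invr_gt0 ?exprn_gt0 ?ltr0n ?prime_gt0 //.
apply: lt_le_trans (archi_boundP _) _; first by rewrite invr_ge0 ltW.
by rewrite -natrX ler_nat ltnW // ltn_expl ?prime_gt1.
Qed.

End IteratedResultants.

Theorem theorem3p2 (p d : nat) (p_prime : prime p) (d_gt0 : (0 < d)%N)
    (f : {mpoly int[d]}) :
  (exists alpha : padic_int p,
     mlim (fun n => iter_res p f n) alpha /\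
     (alpha = 0 <-> (f.@[fun _ => 1] = 0 %[mod p%:Z])%Z)) /\
  (exists beta : padic_int p,
     mlim (fun n => non_p_part p (iter_res p f n)) beta).
Proof.
have pXE k : p%:Z ^+ k = (p ^ k)%N by rewrite -rmorphXn.
split.
  have [alpha [lim_a aE]] := mlim_of_mod p_prime
    (fun N n Nn => iter_res_mod p_prime f Nn (fun _ => leqnn N)).
  exists alpha; split=> //; split=> [a0|/eqP].
    have := aE 1%N; rewrite a0 /= expr1 !mod0z => /esym/dvdz_mod0P pu.
    by apply/dvdz_mod0P; have := iter_res_mod_p p_prime f (fun=> 1%N); rewrite rpredBl.
  rewrite mod0z => /eqP/dvdz_mod0P pf; apply: padic_intP => k.
  rewrite -residue_mod aE /= mod0z; case: d d_gt0 f {lim_a aE alpha} pf => // d' _ f' pf.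
  apply/dvdz_mod0P; rewrite pXE; exact: (iter_res_dvd_pX p_prime).
(* A vanishing term divides all later ones, so the non-p-parts are eventually 0; otherwise the
   congruences between nonzero terms apply throughout. *)
have [[n0 fn0]|nz] := boolp.pselect (exists n, iter_res p f n = 0).
  exists 0 => eps eps0; exists (\max_i n0 i).+1 => // n nN.
  have -> : iter_res p f n = 0.
    apply/eqP; rewrite -dvd0z -fn0; apply: iter_res_dvd => // i.
    by apply: leq_trans (ltnW (ltnW (nN i))); apply: leq_bigmax.
  by rewrite subr0 /non_p_part padic_abs_int // mul0r.
have [//|beta [lim_b _]] := @mlim_of_mod p p_prime d (fun n => non_p_part p (iter_res p f n))
   (fun N => non_p_part p (iter_res p f (fun=> N))) ; last by exists beta.
move=> N n Nn; apply: iter_res_non_p_mod => //.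
by apply/negP => /eqP fn; apply: nz; exists n.
Qed.
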